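(* Let $\beta>1$ and let $X$ be a random variable with density $f_\beta(x)=C_\beta(1+x^2)^{-\beta}$, $x\in\mathbb R$. Then for every $\alpha$ with $1<\alpha<\beta$ and every bounded smooth $\phi:\mathbb R\to\mathbb R$ such that $\phi(X)$ has finite entropy, $$\mathrm{Ent}[\phi^2(X)]\le \frac{2}{\rho_{\beta,\alpha}}\,E\big\{(1+X^2)^\alpha[\phi'(X)]^2\big\},$$ where $$\rho_{\beta,\alpha}=\begin{cases}(2\beta-\alpha)\Big(\dfrac{\alpha-1}{2-\alpha}\Big)^{3-2\alpha}, & 1<\alpha<\tfrac32,\\[2mm] 2\beta-\alpha, & \tfrac32\le\alpha<\beta .\end{cases}$$
   Context: $C_\beta>0$ is the normalizing constant making $f_\beta$ a probability density. For a random variable $X$ with density $f$ on an interval $\mathcal I$, $\mathrm{Ent}[\phi^2(X)]=\int_{\mathcal I}\phi^2\log\phi^2\,f\,dx-\Big(\int_{\mathcal I}\phi^2 f\,dx\Big)\log\Big(\int_{\mathcal I}\phi^2 f\,dx\Big)$. *)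

(* Defs.v *)
From HB Require Import structures.
From mathcomp Require Import all_boot all_order all_algebra.
From mathcomp Require Import all_classical all_reals all_analysis.
Set Implicit Arguments. Unset Strict Implicit. Unset Printing Implicit Defensive.
Import Order.TTheory GRing.Theory Num.Theory.
Import numFieldNormedType.Exports.
Local Open Scope classical_set_scope.
Local Open Scope ring_scope.

Notation leb R := (@lebesgue_measure R).

Definition fb_un (R : realType) (beta : R) (x : R) : R := (1 + x ^+ 2) `^ (- beta).

Definition C_beta (R : realType) (beta : R) : R :=
  (Rintegral (leb R) setT (fb_un beta))^-1.

Definition f_beta (R : realType) (beta : R) (x : R) : R := C_beta beta * fb_un beta x.

(* Ent[g(X)] for a nonnegative g and X with density f:
   \int g log g f - (\int g f) log (\int g f)   (ln 0 = 0, so 0 log 0 = 0) *)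
Definition Ent (R : realType) (f : R -> R) (g : R -> R) : R :=
  Rintegral (leb R) setT (fun x => g x * ln (g x) * f x)
  - Rintegral (leb R) setT (fun x => g x * f x)
    * ln (Rintegral (leb R) setT (fun x => g x * f x)).

Definition smooth (R : realType) (phi : R -> R) : Prop :=
  forall (n : nat) (x : R), derivable (iter n (@derive1 R R) phi) x 1.

Definition rho (R : realType) (beta alpha : R) : R :=
  if alpha < 3 / 2 then
    (2 * beta - alpha) * (((alpha - 1) / (2 - alpha)) `^ (3 - 2 * alpha))
  else 2 * beta - alpha.

(* Main.v *)
Require Import Defs.
From HB Require Import structures.
From mathcomp Require Import all_boot all_order all_algebra.
From mathcomp Require Import all_classical all_reals all_analysis.
From mathcomp Require Import measurable_realfun ring lra.
Set Implicit Arguments.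
Unset Strict Implicit.
Unset Printing Implicit Defensive.
Import Order.TTheory GRing.Theory Num.Theory.
Import numFieldNormedType.Exports.
Local Open Scope classical_set_scope.
Local Open Scope ring_scope.

(** In the coordinate h with h' = 1/a, where a = (1 + x^2)^(alpha/2), the weighted
    Dirichlet form becomes the usual one and the density f_beta becomes
    e^(-V) with V'' >= rho; since alpha > 1, h is bounded.  The log-Sobolev
    inequality then follows from Cordero-Erausquin's transport argument.  If f is
    a positive probability density with respect to w = f_beta and T is the
    monotone map pushing f w to w, then T' = f w / w(T); taking logarithms and
    using ln z <= z - 1 together with the strong convexity of V gives, with
    G = f w a (h(T) - h), the pointwise inequality
      f (ln f) w <= G' + a^2 f'^2 w / (2 rho f).
    As h is bounded and w a tends to 0, integration kills G'.  Applied to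
    f = (phi^2 + e) / m, this yields the theorem when e tends to 0. *)

(** * Elementary bounds on x ln x *)

Section xlnx.
Context {R : realType}.
Implicit Types x t e M : R.

Lemma ln_le_subr1 x : 0 < x -> ln x <= x - 1.
Proof. by move=> x0; have := @le_ln1Dx R (x - 1); rewrite subrKC; apply; lra. Qed.

Lemma xlnx_ge x : 0 < x -> x - 1 <= x * ln x.
Proof.
move=> x0; have xV0 : 0 < x^-1 by rewrite invr_gt0.
have := ln_le_subr1 xV0; rewrite lnV ?posrE// => h.
have : x * - ln x <= x * (x^-1 - 1) by rewrite ler_wpM2l// ltW.
rewrite mulrBr divff ?gt_eqF//; lra.
Qed.

(** Squeezes x ln x between x - 1 and x (x - 1). The uniform bound makes f ln f integrable against
    the weight when f is bounded. *)
Lemma xlnx_norm_le x M : 0 < x -> x <= M -> `|x * ln x| <= 1 + M ^+ 2.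
Proof.
move=> x0 xM; have h1 := xlnx_ge x0.
have h2 : x * ln x <= x * (x - 1) by rewrite ler_wpM2l ?ln_le_subr1// ltW.
rewrite ler_norml; apply/andP; split; nra.
Qed.

(** [ln] is increasing, so each summand may be paired with the logarithm of the whole sum. This
    bounds the entropy integrand of phi^2 + e below by that of phi^2, so e tends to 0 in scalars
    only, never under an integral. *)
Lemma xlnx_superadditive t e : 0 <= t -> 0 < e ->
  t * ln t + e * ln e <= (t + e) * ln (t + e).
Proof.
rewrite le_eqVlt => /predU1P[<- e0|t0 e0]; first by rewrite mul0r !add0r.
by rewrite mulrDl; apply: lerD; rewrite ler_pM2l// ler_ln ?posrE ?addr_gt0//; lra.
Qed.

(** Controls the error of the shift e = t^2 in the final limit. The square makes it linear in t: t^2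
    ln (t^2) = 2 t (t ln t) >= 2 t (t - 1), and the other terms are O(t) by ln z <= z - 1. *)
Lemma xlnxD_le m t : 0 <= m -> 0 < t <= 1 ->
  (m + t ^+ 2) * ln (m + t ^+ 2) - t ^+ 2 * ln (t ^+ 2) <=
  m * ln m + (4 + m) * t.
Proof.
move=> m0 /andP[t0 t1].
have t20 : 0 < t ^+ 2 by rewrite exprn_gt0.
have mt0 : 0 < m + t ^+ 2 by rewrite ltr_wpDl.
have h1 : - (2 * t) <= t ^+ 2 * ln (t ^+ 2).
  by rewrite lnXn// -mulr_natr; have := xlnx_ge t0; nra.
have h2 : t ^+ 2 * ln (m + t ^+ 2) <= t ^+ 2 * (m + t ^+ 2 - 1).
  by rewrite ler_pM2l// ln_le_subr1.
have h3 : m * ln (m + t ^+ 2) <= m * ln m + t ^+ 2.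
  move: m0; rewrite le_eqVlt => /predU1P[<-|m0]; first by rewrite !mul0r add0r ltW.
  have : ln ((m + t ^+ 2) / m) <= (m + t ^+ 2) / m - 1.
    by rewrite ln_le_subr1// divr_gt0.
  rewrite ln_div ?posrE// => /(ler_wpM2l (ltW m0)).
  rewrite !mulrBr mulrCA divff ?gt_eqF// mulr1; lra.
rewrite mulrDl.
have tt : t ^+ 2 <= t by rewrite expr2; nra.
have : t ^+ 2 * (m + t ^+ 2 - 1) <= t * m by nra.
lra.
Qed.

End xlnx.

(** * Primitives, monotone transport, and convexity in a changed coordinate *)

Section calculus.
Context {R : realType}.
Implicit Types (f g w h : R -> R).

Lemma is_derive_continuous f (df : R -> R) :
  (forall x : R, is_derive x 1 f (df x)) -> continuous f.
Proof.
move=> fd x; apply: differentiable_continuous; apply/derivable1_diffP.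
by have [] := fd x.
Qed.

Lemma is_derive_ge0_le f (df : R -> R) (a b : R) : a <= b ->
  (forall x : R, is_derive x 1 f (df x)) ->
  (forall x, a <= x <= b -> 0 <= df x) -> f a <= f b.
Proof.
move=> ab fd df0.
have cf := is_derive_continuous fd.
have [c] := @MVT_segment _ f df a b ab (fun x _ => fd x) (continuous_subspaceT cf).
rewrite in_itv/= => /df0 dc e; rewrite -subr_ge0 e mulr_ge0// subr_ge0//.
Qed.

Lemma is_derive_gt0_lt f (df : R -> R) (a b : R) : a < b ->
  (forall x : R, is_derive x 1 f (df x)) ->
  (forall x, 0 < df x) -> f a < f b.
Proof.
move=> ab fd df0.
have cf := is_derive_continuous fd.
have [c _ e] := @MVT _ f df a b ab (fun x _ => fd x) (continuous_subspaceT cf).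
by rewrite -subr_gt0 e mulr_gt0// subr_gt0.
Qed.

(** The distribution function when [g] is a density; it also supplies the bounded coordinate h. *)
Definition prim g (x : R) : R := \int[leb R]_(t in `]-oo, x]) g t.

Lemma is_derive_prim g (x : R) : continuous g ->
  (leb R).-integrable setT (EFin \o g) -> is_derive x 1 (prim g) (g x).
Proof.
move=> cg ig.
have [||||d <-] := @continuous_FTC1 R g -oo%O x (x + 1).
- by rewrite ltrDl.
- exact: integrableS ig.
- by rewrite ltNyr.
- exact: cg.
- by rewrite derive1E; apply: DeriveDef.
Qed.

Lemma prim_cvgy g : (leb R).-integrable setT (EFin \o g) ->
  prim g n%:R @[n --> \oo] --> \int[leb R]_t g t.
Proof.
move=> ig; apply: fine_cvg; rewrite /= fineK; last exact: integrable_fin_num.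
under eq_fun do rewrite integral_mkcond.
have mg := measurable_int _ ig.
have [] := @dominated_convergence _ _ _ (leb R) setT measurableT
  (fun n => (EFin \o g) \_ `]-oo, n%:R]) (EFin \o g) (abse \o (EFin \o g)).
- move=> n; apply: (measurable_int (leb R)); rewrite -integrable_mkcond//.
  exact: integrableS ig.
- exact: mg.
- apply/aeW => x _; apply: cvg_near_cst.
  exists (Num.truncn x).+1 => // n /= xn; rewrite patchE mem_set//= in_itv/=.
  apply: ltW; apply: lt_le_trans (truncnS_gt x) _.
  by rewrite ler_nat.
- exact: integrable_abse.
- apply/aeW => x n _; rewrite patchE; case: ifP => //= _.
  by rewrite normr0 lee_fin.
- by [].
Qed.

Lemma prim_cvgNy g : (leb R).-integrable setT (EFin \o g) ->
  prim g (- n%:R) @[n --> \oo] --> (0 : R).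
Proof.
move=> ig; apply: fine_cvg.
under eq_fun do rewrite integral_mkcond.
have mg := measurable_int _ ig.
have [] := @dominated_convergence _ _ _ (leb R) setT measurableT
  (fun n => (EFin \o g) \_ `]-oo, (- n%:R)]) (cst 0%E) (abse \o (EFin \o g)).
- move=> n; apply: (measurable_int (leb R)); rewrite -integrable_mkcond//.
  exact: integrableS ig.
- exact: measurable_cst.
- apply/aeW => x _; apply: cvg_near_cst.
  exists (Num.truncn (- x)).+1 => // n /= xn; rewrite patchE memNset//= in_itv/=.
  apply/negP; rewrite -ltNge ltrNl; apply: lt_le_trans (truncnS_gt _) _.
  by rewrite ler_nat.
- exact: integrable_abse.
- apply/aeW => x n _; rewrite patchE; case: ifP => //= _.
  by rewrite normr0 lee_fin.
- by rewrite integral0.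
Qed.

(** [prim g] is strictly increasing, and comparison with its values at x - 1 and x + 1 makes both
    bounds strict. *)
Lemma prim_gt0_lt g (x : R) : continuous g -> (forall t, 0 < g t) ->
  (leb R).-integrable setT (EFin \o g) ->
  0 < prim g x < \int[leb R]_t g t.
Proof.
move=> cg g0 ig.
have inc a b : a < b -> prim g a < prim g b.
  by move=> ab; apply: (is_derive_gt0_lt ab (fun x => is_derive_prim x cg ig)).
apply/andP; split.
- apply: (@le_lt_trans _ _ (prim g (x - 1))); last by apply: inc; rewrite ltrBlDr ltrDl.
  by apply: Rintegral_ge0 => t _; exact: ltW.
- apply: (@lt_le_trans _ _ (prim g (x + 1))); first by apply: inc; rewrite ltrDl.
  apply: (@ler_cvg_to _ \oo _ R (fun=> prim g (x + 1)) (fun n => prim g n%:R)).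
  + exact: cvg_cst.
  + exact: prim_cvgy.
  + exists (Num.truncn (x + 1)).+1 => // n /= xn; apply/ltW/inc.
    apply: lt_le_trans (truncnS_gt (x + 1)) _.
    by rewrite ler_nat.
Qed.

Lemma prim_surj g (v : R) : continuous g ->
  (leb R).-integrable setT (EFin \o g) -> \int[leb R]_t g t = 1 ->
  0 < v < 1 -> exists x, prim g x = v.
Proof.
move=> cg ig g1 /andP[v0 v1].
have dp := fun x => is_derive_prim x cg ig.
have := prim_cvgy ig; rewrite g1 => /cvgr_ge/(_ _ v1)[n1 _ h1].
have := prim_cvgNy ig => /cvgr_le/(_ _ v0)[n2 _ h2].
have [|||c _ <-] := @IVT R (prim g) (- n2%:R) n1%:R v.
- by rewrite (@le_trans _ _ 0)// oppr_le0.
- exact/continuous_subspaceT/(is_derive_continuous dp).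
- by rewrite ge_min (h2 n2)//= le_max (h1 n1)//= orbT.
- by exists c.
Qed.

(** T is the inverse of [prim w] composed with [prim g], so [prim w (T x) = prim g x]; the inverse
    function and chain rules give its derivative. *)
Lemma monotone_transport w g :
  continuous w -> (forall t, 0 < w t) ->
  (leb R).-integrable setT (EFin \o w) -> \int[leb R]_t w t = 1 ->
  continuous g -> (forall t, 0 < g t) ->
  (leb R).-integrable setT (EFin \o g) -> \int[leb R]_t g t = 1 ->
  exists T : R -> R, forall x : R, is_derive x 1 T (g x / w (T x)).
Proof.
move=> cw w0 iw w1 cg g0 ig g1.
have dw := fun x => is_derive_prim x cw iw.
have /choice[S SP] : forall v, exists x, 0 < v < 1 -> prim w x = v.
  (* The value 0 is a default outside (0, 1); [prim w] and [prim g] take their values inside. *)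
  move=> v; have [v01|/negP v01] := boolP (0 < v < 1); last by exists 0.
  by have [x xv] := prim_surj cw iw w1 v01; exists x.
have primK : cancel (prim w) S.
  move=> x; have := prim_gt0_lt x cw w0 iw; rewrite w1 => /SP.
  have inc := is_derive_gt0_lt _ dw w0.
  by case: (ltgtP (S (prim w x)) x) => // /inc /[swap] ->; rewrite ltxx.
exists (S \o prim g) => x.
have := prim_gt0_lt x cg g0 ig; rewrite g1 => /SP e.
rewrite mulrC; apply: is_derive1_comp; last exact: is_derive_prim.
rewrite -[X in is_derive X]e; apply: is_derive_inverse.
- by apply: filterE => y; exact: primK.
- by apply: filterE => y; exact: is_derive_continuous dw _.
- by rewrite gt_eqF.
Qed.

(** As h' = 1 / a, [q] is the derivative of [V] with respect to [h], and [a * dq] is the second one.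
    This is therefore the tangent inequality at x for a function strongly convex in the coordinate
    [h]. *)
Lemma weighted_convexity (a h V q dq : R -> R) (rho x t : R) :
  (forall y, 0 < a y) ->
  (forall y : R, is_derive y 1 h (a y)^-1) ->
  (forall y : R, is_derive y 1 V (q y / a y)) ->
  (forall y : R, is_derive y 1 q (dq y)) ->
  (forall y, rho <= a y * dq y) ->
  q x * (h t - h x) + rho / 2 * (h t - h x) ^+ 2 <= V t - V x.
Proof.
move=> a0 dh dV dQ rq.
(* The derivative of V - rho h^2 / 2 with respect to [h], nondecreasing by [rq]. *)
pose b y := q y - rho * h y.
have db (y : R) : is_derive y 1 b (dq y - rho * (a y)^-1) by exact: is_deriveB.
have b_ge0 y : 0 <= dq y - rho * (a y)^-1.
  by rewrite subr_ge0 ler_pdivrMr// mulrC.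
have b_le y z : y <= z -> b y <= b z.
  by move=> yz; apply: (is_derive_ge0_le yz db) => // *.
(* The sign of D' at y is that of b y - b x, so [D] is least at x. *)
pose D y := V y - q x * (h y - h x) - rho / 2 * (h y - h x) ^+ 2.
have dD (y : R) : is_derive y 1 D ((b y - b x) / a y).
  rewrite /D; apply: is_derive_eq.
  rewrite /b /GRing.scale/=; by field; rewrite gt_eqF.
suff : D x <= D t by rewrite /D; lra.
have [xt|tx] := leP x t.
- apply: (is_derive_ge0_le xt dD) => y /andP[xy _].
  by rewrite divr_ge0 ?subr_ge0 ?b_le// ltW.
- rewrite -lerN2.
  apply: (is_derive_ge0_le (ltW tx) (fun y => is_deriveN (dD y))) => y /andP[_ yx].
  by rewrite -mulNr opprB divr_ge0 ?subr_ge0 ?b_le// ltW.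
Qed.

End calculus.

Lemma integrable_boundedM (R : realType) (g w : R -> R) (M : R) :
  continuous g -> continuous w -> (leb R).-integrable setT (EFin \o w) ->
  (forall x, `|g x| <= M) -> (leb R).-integrable setT (EFin \o (g \* w)).
Proof.
move=> cg cw iw gM.
apply: (le_integrable measurableT _ _ (integrableZl measurableT M iw)).
- apply/measurable_EFinP; apply: continuous_measurable_fun => x.
  by apply: continuousM; [exact: cg|exact: cw].
- move=> x _ /=; rewrite lee_fin !normrM ler_wpM2r//.
  exact: le_trans (gM x) (ler_norm _).
Qed.

(** * The log-Sobolev inequality for an abstract weight, by transport *)

Section log_sobolev.
Context {R : realType}.
Variables (w a h V q dq : R -> R) (rho B : R).
Hypotheses (rho0 : 0 < rho) (cw : continuous w) (w0 : forall x, 0 < w x)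
  (iw : (leb R).-integrable setT (EFin \o w)) (w1 : \int[leb R]_x w x = 1)
  (a0 : forall x, 0 < a x)
  (dh : forall x : R, is_derive x 1 h (a x)^-1)
  (hB : forall x, `|h x| <= B)
  (dV : forall x : R, is_derive x 1 V (q x / a x))
  (dQ : forall x : R, is_derive x 1 q (dq x))
  (rq : forall x, rho <= a x * dq x)
  (waV : forall x, w x * a x = expR (- V x))
  (way : w n%:R * a n%:R @[n --> \oo] --> (0 : R))
  (waNy : w (- n%:R) * a (- n%:R) @[n --> \oo] --> (0 : R)).

Section density.
Variables (f df : R -> R) (M : R).
Hypotheses (f0 : forall x, 0 < f x) (fM : forall x, f x <= M)
  (dF : forall x : R, is_derive x 1 f (df x)).

Section transport.
Variable T : R -> R.
Hypothesis dT : forall x : R, is_derive x 1 T (f x * w x / w (T x)).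

(** The boundary term f w a (h(T) - h), with [w * a] written as [expR (- V x)] so that [dV] yields
    its derivative. *)
Let G x := f x * expR (- V x) * (h (T x) - h x).
Let dG x := df x * expR (- V x) * (h (T x) - h x)
  + f x * (- (q x / a x) * expR (- V x)) * (h (T x) - h x)
  + f x * expR (- V x) * ((a (T x))^-1 * (f x * w x / w (T x)) - (a x)^-1).

Let dGP (x : R) : is_derive x 1 G (dG x).
Proof.
have dhT : is_derive x 1 (h \o T) ((a (T x))^-1 * (f x * w x / w (T x))).
  exact: is_derive1_comp.
have dE : is_derive x 1 (expR \o (- V)) (expR (- V x) * - (q x / a x)).
  exact: is_derive1_comp.
have -> : G = f * (expR \o (- V)) * (h \o T - h) by [].
apply: is_derive_eq; rewrite /dG /GRing.scale/= !fctE; ring.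
Qed.

Lemma entropy_pointwise x :
  f x * ln (f x) * w x <= dG x + (a x ^+ 2 * df x ^+ 2 / f x * w x) / (2 * rho).
Proof.
set t := T x.
have at0 := a0 t; have ax0 := a0 x; have wt0 := w0 t; have wx0 := w0 x.
have fx0 := f0 x.
(* By [dT], [z] is the derivative of h(T) with respect to h, that is, the Jacobian of the transport
   in that coordinate. *)
pose z := f x * (w x * a x) / (w t * a t).
have z0 : 0 < z by rewrite !(divr_gt0, mulr_gt0).
have lnf : ln (f x) = ln z + V x - V t.
  have -> : f x = z * expR (V x - V t).
    rewrite /z !waV expRB !expRN.
    by field; rewrite !gt_eqF ?expR_gt0.
  by rewrite lnM ?posrE ?expR_gt0// expRK addrA.
have lnz : ln z <= z - 1 by exact: ln_le_subr1.
have cvx := weighted_convexity x t a0 dh dV dQ rq.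
set th := h t - h x in cvx *.
have step1 : f x * ln (f x) * w x <=
    f x * w x * (z - 1 - q x * th - rho / 2 * th ^+ 2).
  rewrite mulrAC ler_pM2l ?mulr_gt0// lnf; lra.
apply: le_trans step1 _.
have -> : dG x = df x * (w x * a x) * th + f x * w x * (z - 1 - q x * th).
  rewrite /dG -!waV -/t -/th /z.
  by field; rewrite !gt_eqF.
rewrite -subr_ge0.
(* Completing the square in [th] absorbs the cross term with f' into the convexity gain; this
   produces the constant 1 / (2 rho). *)
rewrite [leRHS](_ : _ =
  w x * f x / (2 * rho) * (rho * th + a x * df x / f x) ^+ 2); last first.
  by field; rewrite !gt_eqF.
by rewrite mulr_ge0 ?sqr_ge0// !(divr_ge0, mulr_ge0)// ltW.
Qed.

(** As f <= M and |h| <= B, |G| <= 2 M B w a, however T behaves at infinity. *)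
Lemma transport_boundary_cvg (y : nat -> R) :
  w (y n) * a (y n) @[n --> \oo] --> (0 : R) -> G (y n) @[n --> \oo] --> (0 : R).
Proof.
move=> wa0; apply/norm_cvg0P.
have : w (y n) * a (y n) * (M * (B + B)) @[n --> \oo] --> (0 : R).
  by rewrite -[X in _ --> X](mul0r (M * (B + B))); apply: cvgM => //; exact: cvg_cst.
apply: (squeeze_cvgr _ (cvg_cst 0)); apply: nearW => n.
rewrite normr_ge0/= /G -waV [f _ * _]mulrC !normrM -mulrA -normrM.
have wa_ge0 : 0 <= w (y n) * a (y n) by rewrite ltW// mulr_gt0.
rewrite (ger0_norm wa_ge0) ler_wpM2l//.
rewrite ler_pM//; first by rewrite ger0_norm ?fM// ltW.
by rewrite (le_trans (ler_normB _ _))// lerD.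
Qed.

(** [K] is a continuous integrable majorant of the Fisher information integrand; continuity lets
    [prim K] be differentiated everywhere. *)
Lemma entropy_le_of_transport K :
  continuous K -> (leb R).-integrable setT (EFin \o K) ->
  (forall x, a x ^+ 2 * df x ^+ 2 / f x * w x <= K x) ->
  (leb R).-integrable setT (fun x => (f x * ln (f x) * w x)%:E) ->
  \int[leb R]_x (f x * ln (f x) * w x) <= (\int[leb R]_x K x) / (2 * rho).
Proof.
move=> cK iK leK iflnf.
have cf : continuous f := is_derive_continuous dF.
have cflnf : continuous (fun x => f x * ln (f x) * w x).
  move=> x; apply: cvgM; last exact: cw.
  apply: cvgM; first exact: cf.
  by apply: continuous_comp; [exact: cf|exact: continuous_ln].
pose A := prim (fun x => f x * ln (f x) * w x).
have dA (x : R) : is_derive x 1 A (f x * ln (f x) * w x) by exact: is_derive_prim.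
have dK (x : R) : is_derive x 1 (prim K) (K x) by exact: is_derive_prim.
(* The pointwise inequality says P' >= 0. Comparing the limits of P at -n and n replaces the
   integration of G', whose integrability is thus never at issue. *)
pose P := G + (2 * rho)^-1 *: prim K - A.
have dP (x : R) : is_derive x 1 P (dG x + K x / (2 * rho) - f x * ln (f x) * w x).
  have dGK := is_deriveD (dGP x) (is_deriveZ (2 * rho)^-1 (dK x)).
  by apply: is_derive_eq (is_deriveB dGK (dA x)) _; rewrite [_ / _]mulrC.
have dP0 x : 0 <= dG x + K x / (2 * rho) - f x * ln (f x) * w x.
  rewrite subr_ge0 (le_trans (entropy_pointwise x))// lerD2l.
  by rewrite ler_wpM2r ?leK// invr_ge0 mulr_ge0// ltW.
have Pn (n : nat) : P (- n%:R) <= P n%:R.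
  apply: (is_derive_ge0_le _ dP) => // *; first by rewrite (@le_trans _ _ 0)// oppr_le0.
have cy : P n%:R @[n --> \oo] -->
    0 + (2 * rho)^-1 * (\int[leb R]_x K x) - \int[leb R]_x (f x * ln (f x) * w x).
  apply: cvgB; last exact: prim_cvgy.
  apply: cvgD; first exact: transport_boundary_cvg.
  by apply: cvgM; [exact: cvg_cst|exact: prim_cvgy].
have cNy : P (- n%:R) @[n --> \oo] --> 0 + (2 * rho)^-1 * 0 - (0 : R).
  apply: cvgB; last exact: prim_cvgNy.
  apply: cvgD; first exact: transport_boundary_cvg.
  by apply: cvgM; [exact: cvg_cst|exact: prim_cvgNy].
have := ler_cvg_to cNy cy (nearW _ Pn).
by rewrite mulr0 !add0r oppr0 subr_ge0 [_^-1 * _]mulrC; apply.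
Qed.

End transport.

Lemma entropy_le K :
  continuous K -> (leb R).-integrable setT (EFin \o K) ->
  (forall x, a x ^+ 2 * df x ^+ 2 / f x * w x <= K x) ->
  (leb R).-integrable setT (fun x => (f x * ln (f x) * w x)%:E) ->
  \int[leb R]_x (f x * w x) = 1 ->
  \int[leb R]_x (f x * ln (f x) * w x) <= (\int[leb R]_x K x) / (2 * rho).
Proof.
move=> cK iK leK iflnf fw1.
have cf : continuous f := is_derive_continuous dF.
have [|||T dT] := monotone_transport (g := f \* w) cw w0 iw w1 _ _ _ fw1.
- by move=> x; apply: continuousM; [exact: cf|exact: cw].
- by move=> x; rewrite mulr_gt0.
- by apply: (@integrable_boundedM _ _ _ M) => // x; rewrite ger0_norm// ltW.
- exact: (@entropy_le_of_transport T).
Qed.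

End density.
End log_sobolev.

(** * Weighted means and powers of 1 + x^2 *)

Section powers.
Context {R : realType}.
Implicit Types x s t : R.

(** Concavity of [ln]: the tangent at the weighted mean m bounds ln A and ln B, and the linear terms
    cancel in the weighted sum. *)
Lemma weighted_AMGM (A B p : R) : 0 < A -> 0 < B -> 0 <= p <= 1 ->
  A `^ (1 - p) * B `^ p <= (1 - p) * A + p * B.
Proof.
move=> A0 B0 /andP[p0 p1].
have [m mE] : exists m, m = (1 - p) * A + p * B by eexists.
rewrite -mE; have m0 : 0 < m.
  (* One of the two weights is at least 1/2, which keeps m away from 0. *)
  by have [p12|p12] := leP p (1 / 2); rewrite mE; nra.
have lnle (X : R) : 0 < X -> ln X <= ln m + (X / m - 1).
  move=> X0; rewrite -lerBlDl -ln_div ?posrE//.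
  by rewrite ln_le_subr1// divr_gt0.
rewrite -[leRHS]lnK ?posrE// -[leLHS]lnK ?posrE ?mulr_gt0 ?powR_gt0//.
rewrite ler_expR lnM ?posrE ?powR_gt0// !ln_powR.
have hA : (1 - p) * ln A <= (1 - p) * (ln m + (A / m - 1)).
  by rewrite ler_wpM2l ?lnle// subr_ge0.
have hB : p * ln B <= p * (ln m + (B / m - 1)) by rewrite ler_wpM2l ?lnle.
apply: le_trans (lerD hA hB) _.
rewrite [leLHS](_ : _ = ln m + (((1 - p) * A + p * B) / m - 1)); last first.
  by field; rewrite gt_eqF.
by rewrite -mE divff ?gt_eqF// subrr addr0.
Qed.

Lemma onesqr_ge1 x : 1 <= 1 + x ^+ 2.
Proof. by rewrite lerDl sqr_ge0. Qed.

Lemma onesqr_gt0 x : 0 < 1 + x ^+ 2.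
Proof. exact: lt_le_trans ltr01 (onesqr_ge1 x). Qed.

Lemma powRD_gt0 x s t : 0 < x -> x `^ (s + t) = x `^ s * x `^ t.
Proof. by move=> x0; rewrite powRD// (gt_eqF x0) implybT. Qed.

Lemma is_derive_onesqr_powR s x :
  is_derive x 1 (fun y => (1 + y ^+ 2) `^ s) (2 * s * x * (1 + x ^+ 2) `^ (s - 1)).
Proof.
have d1 : is_derive x 1 (fun y : R => 1 + y ^+ 2) (2 * x).
  by apply: is_derive_eq; rewrite /GRing.scale/=; ring.
have d2 : is_derive (1 + x ^+ 2) 1 (@powR R ^~ s) (s * (1 + x ^+ 2) `^ (s - 1)).
  exact/is_derive1_powR/onesqr_gt0.
have := @is_derive1_comp _ _ (fun y : R => 1 + y ^+ 2) _ _ _ d2 d1.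
rewrite [X in is_derive _ _ _ X](_ : _ = 2 * s * x * (1 + x ^+ 2) `^ (s - 1))//; ring.
Qed.

Lemma continuous_onesqr_powR s : continuous (fun x : R => (1 + x ^+ 2) `^ s).
Proof. exact: is_derive_continuous (is_derive_onesqr_powR s). Qed.

(** Trades powers of 1 + x^2 for powers of 1 + x, which have explicit primitives and an evident
    decay. *)
Lemma onesqr_powR_half_ge x : 1 + x <= 2 * (1 + x ^+ 2) `^ (1 / 2).
Proof.
set r := _ `^ _; have r0 : 0 <= r by exact: powR_ge0.
have r2 : r ^+ 2 = 1 + x ^+ 2.
  rewrite -powR_mulrn// -powRrM divfK ?pnatr_eq0// powRr1//.
  exact/ltW/onesqr_gt0.
have := sqr_ge0 (1 - x); nra.
Qed.

Lemma powRN_cvg0 t : 0 < t -> (1 + x) `^ (- t) @[x --> +oo] --> (0 : R).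
Proof.
move=> t0; apply/cvgr0Pnorm_lt => e e0; near=> x.
have x0 : 0 < x by near: x; exact: nbhs_pinfty_gt.
have xe : (e^-1) `^ (t^-1) < x by near: x; apply: nbhs_pinfty_gt; exact: num_real.
rewrite ger0_norm ?powR_ge0// powRN invf_plt ?posrE ?powR_gt0 ?addr_gt0//.
rewrite -[X in X < _](_ : ((e^-1) `^ (t^-1)) `^ t = e^-1); last first.
  by rewrite -powRrM mulVf ?gt_eqF// powRr1// ltW// invr_gt0.
rewrite gt0_ltr_powR ?nnegrE ?powR_ge0//; first by rewrite addr_ge0// ltW.
by rewrite (lt_trans xe)// ltrDr.
Unshelve. all: by end_near. Qed.

(** By symmetry the half-line suffices; there the integrand is dominated by c (1 + x)^(-2s), whose
    primitive [F] vanishes at infinity as 2s > 1. *)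
Lemma integrable_onesqr_powRN s : 1 / 2 < s ->
  (leb R).-integrable setT (EFin \o (fun x => (1 + x ^+ 2) `^ (- s))).
Proof.
move=> s12.
pose k x := (1 + x ^+ 2) `^ (- s).
have ck : continuous k by exact: continuous_onesqr_powR.
have k0 x : 0 <= k x by exact: powR_ge0.
apply/integrableP; split.
  by apply/measurable_EFinP; apply: continuous_measurable_fun; exact: ck.
under eq_integral do rewrite /= ger0_norm ?k0//.
rewrite ge0_symfun_integralT//; last by move=> x /=; rewrite sqrrN.
rewrite lte_mul_pinfty// -set_itvcy.
(* The factor 2 of [onesqr_powR_half_ge], raised to the power 2s. *)
pose c : R := 2 `^ (2 * s).
pose F x := - c / (2 * s - 1) * (1 + x) `^ (- (2 * s - 1)).
have dpow p x : 0 <= x ->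
    is_derive x 1 (fun y : R => (1 + y) `^ p) (p * (1 + x) `^ (p - 1)).
  move=> x0; have x10 : 0 < 1 + x by rewrite ltr_pwDl.
  have d1 : is_derive x 1 (fun y : R => 1 + y) 1.
    by apply: is_derive_eq; rewrite add0r mulr1.
  have := @is_derive1_comp _ _ (fun y : R => 1 + y) _ _ _ (is_derive1_powR p x10) d1.
  by rewrite mulr1.
have dF x : 0 <= x -> is_derive x 1 F (c * (1 + x) `^ (- (2 * s))).
  move=> x0; have d3 := dpow (- (2 * s - 1)) _ x0.
  rewrite /F; apply: is_derive_eq; rewrite /GRing.scale/=.
  rewrite (_ : - (2 * s - 1) - 1 = - (2 * s)); last by ring.
  field; lra.
have cf x : 0 <= x -> {for x, continuous (fun y : R => c * (1 + y) `^ (- (2 * s)))}.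
  move=> x0; apply: cvgM; first exact: cvg_cst.
  have cp : {for x, continuous (fun y : R => (1 + y) `^ (- (2 * s)))}.
    apply: differentiable_continuous; apply/derivable1_diffP.
    by have [] := dpow (- (2 * s)) _ x0.
  exact: cp.
have cfw : {within `[0, +oo[, continuous (fun x : R => c * (1 + x) `^ (- (2 * s)))}.
  apply: continuous_in_subspaceT => x; rewrite inE/= in_itv/= andbT; exact: cf.
apply: (@le_lt_trans _ _
  (\int[leb R]_(x in `[0%R, +oo[) (c * (1 + x) `^ (- (2 * s)))%:E)%E).
  apply: ge0_le_integral => //.
  - by move=> x _; rewrite lee_fin powR_ge0.
  - apply/measurable_EFinP; apply: measurable_funTS.
    by apply: continuous_measurable_fun; exact: ck.
  - by apply/measurable_EFinP; apply: subspace_continuous_measurable_fun.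
  - move=> x; rewrite /= in_itv/= andbT => x0; rewrite lee_fin.
    have x10 : 0 < 1 + x by rewrite ltr_pwDl.
    rewrite /k /c 2!powRN ler_pdivlMr ?powR_gt0// mulrC.
    rewrite ler_pdivrMr; last exact/powR_gt0/onesqr_gt0.
    have -> : (1 + x ^+ 2) `^ s = ((1 + x ^+ 2) `^ (1 / 2)) `^ (2 * s).
      rewrite -powRrM; congr powR; by field.
    rewrite -powRM// ?powR_ge0//.
    rewrite ge0_ler_powR ?nnegrE ?mulr_ge0 ?powR_ge0 ?onesqr_powR_half_ge ?ltW//; lra.
rewrite (@ge0_continuous_FTC2y _ _ F _ 0) ?ltry//.
- by move=> x _; rewrite mulr_ge0 ?powR_ge0.
- rewrite -[X in _ --> X](mulr0 (- c / (2 * s - 1))).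
  apply: cvgM; first exact: cvg_cst.
  by apply: powRN_cvg0; lra.
- by move=> x x0; have [] := dF _ (ltW x0).
- apply: cvg_at_right_filter; apply: differentiable_continuous; apply/derivable1_diffP.
  by have [] := dF _ (lexx 0).
- move=> x; rewrite in_itv/= andbT => /ltW/dF[_ <-]; rewrite derive1E//.
Qed.

End powers.

(** * The density [f_beta]: convexity constant, decay, and log-Sobolev inequality *)

Section generalized_cauchy.
Context {R : realType}.
Variables alpha beta : R.
Hypotheses (alpha1 : 1 < alpha) (alphabeta : alpha < beta).

Lemma rho_gt0 : 0 < rho beta alpha.
Proof.
have a_gt1 := alpha1; have a_ltb := alphabeta.
have ab : 0 < 2 * beta - alpha by lra.
by rewrite /rho; case: ifPn => // a32; rewrite mulr_gt0// powR_gt0// divr_gt0//; lra.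
Qed.

(** With u = 1 + x^2 the right-hand side is the second derivative of the potential in the coordinate
    h, so [rho] is its convexity constant. *)
Lemma rho_le (u : R) : 1 <= u ->
  rho beta alpha <=
  (2 * beta - alpha) * (u `^ (alpha - 2) * (2 - alpha + (alpha - 1) * u)).
Proof.
have a_gt1 := alpha1; have a_ltb := alphabeta.
move=> u1; have u0 : 0 < u by lra.
have ab : 0 < 2 * beta - alpha by lra.
have key c : c * u `^ (2 - alpha) <= 2 - alpha + (alpha - 1) * u ->
    c <= u `^ (alpha - 2) * (2 - alpha + (alpha - 1) * u).
  move=> cu; rewrite -[leLHS](_ : u `^ (alpha - 2) * (c * u `^ (2 - alpha)) = c).
    by rewrite ler_wpM2l// powR_ge0.
  by rewrite mulrCA -powRD_gt0// addrA subrK subrr powRr0 mulr1.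
rewrite /rho; case: ifPn => [a32|]; rewrite -?leNgt => *; last first.
  rewrite -[leLHS]mulr1 ler_pM2l//; apply: key; rewrite mul1r.
  have [a2|a2] := leP alpha 2.
    (* This gives u^(2 - alpha) <= alpha - 1 + (2 - alpha) u; swapping the two coefficients costs
       nothing, since (2 alpha - 3)(u - 1) >= 0. *)
    have := @weighted_AMGM R 1 u (2 - alpha) ltr01 u0; rewrite powR1 mul1r.
    move=> /(_ _)/le_trans; apply; nra.
  apply: (@le_trans _ _ 1); last nra.
  by rewrite -[leRHS](powRr0 u) ler_powR// subr_le0 ltW.
rewrite ler_pM2l//; apply: key.
(* Chosen so that (alpha - 1) / r = 2 - alpha and (2 - alpha) r = alpha - 1: the mean of 1 / r and r
   u is then the required sum, and their geometric mean is r^(3 - 2 alpha) u^(2 - alpha). *)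
set r := (alpha - 1) / (2 - alpha).
have r0 : 0 < r by rewrite divr_gt0//; lra.
have rV0 : 0 < r^-1 by rewrite invr_gt0.
have p01 : 0 <= 2 - alpha <= 1 by apply/andP; split; lra.
(* equality holds at the minimiser u = r^-2 of the right-hand side *)
have amgm := weighted_AMGM rV0 (mulr_gt0 r0 u0) p01.
have -> : 2 - alpha + (alpha - 1) * u = (1 - (2 - alpha)) * r^-1 + (2 - alpha) * (r * u).
  by rewrite /r; field; rewrite !gt_eqF//; lra.
apply: le_trans amgm.
rewrite (powRM _ (ltW r0) (ltW u0)) mulrA ler_wpM2r ?powR_ge0//.
rewrite -(powR_inv1 (ltW r0)) -powRrM -powRD_gt0// le_eqVlt; apply/orP; left.
by apply/eqP; congr powR; ring.
Qed.

Lemma integrable_fb_un : (leb R).-integrable setT (EFin \o fb_un beta).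
Proof.
have a_gt1 := alpha1; have a_ltb := alphabeta.
by apply: integrable_onesqr_powRN; lra.
Qed.

Lemma C_beta_gt0 : 0 < C_beta beta.
Proof.
rewrite invr_gt0.
have := prim_gt0_lt 0 (@continuous_onesqr_powR R (- beta)).
move=> /(_ (fun t => powR_gt0 _ (onesqr_gt0 t)) integrable_fb_un).
by move=> /andP[]; exact: lt_trans.
Qed.

Lemma f_beta_gt0 x : 0 < f_beta beta x.
Proof. by rewrite mulr_gt0 ?C_beta_gt0// powR_gt0// onesqr_gt0. Qed.

Lemma continuous_f_beta : continuous (f_beta beta).
Proof.
move=> x; apply: cvgM; first exact: cvg_cst.
exact: continuous_onesqr_powR.
Qed.

Lemma integrable_f_beta : (leb R).-integrable setT (EFin \o f_beta beta).
Proof. exact: (integrableZl measurableT (C_beta beta) integrable_fb_un). Qed.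

Lemma Rintegral_f_beta : \int[leb R]_x f_beta beta x = 1.
Proof.
rewrite /f_beta RintegralZl//; last exact: integrable_fb_un.
by rewrite mulVf// -invr_eq0 gt_eqF// C_beta_gt0.
Qed.

Let a (x : R) := (1 + x ^+ 2) `^ (alpha / 2).
(** Minus the logarithm of [f_beta beta x * a x]; [q] below is a V'. *)
Let V (x : R) := (beta - alpha / 2) * ln (1 + x ^+ 2) - ln (C_beta beta).
Let q (x : R) := (2 * beta - alpha) * (x * (1 + x ^+ 2) `^ (alpha / 2 - 1)).

Lemma f_beta_weight x :
  f_beta beta x * a x = C_beta beta * (1 + x ^+ 2) `^ (- (beta - alpha / 2)).
Proof.
rewrite /f_beta /fb_un /a -mulrA -powRD_gt0 ?onesqr_gt0//.
by congr (_ * powR _ _); ring.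
Qed.

(** Since 2 beta - alpha > beta > 1, the exponent beta - alpha / 2 exceeds 1/2 and the product is
    O(1 / n). The condition on squares covers both y n = n and y n = -n. *)
Lemma f_beta_weight_cvg0 (y : nat -> R) : (forall n, y n ^+ 2 = n%:R ^+ 2) ->
  f_beta beta (y n) * a (y n) @[n --> \oo] --> (0 : R).
Proof.
have a_gt1 := alpha1; have a_ltb := alphabeta.
move=> yE.
have : C_beta beta * 2 * harmonic n @[n --> \oo] --> (0 : R).
  rewrite -[X in _ --> X](mulr0 (C_beta beta * 2)).
  by apply: cvgM; [exact: cvg_cst|exact: cvg_harmonic].
apply: (squeeze_cvgr _ (cvg_cst 0)); apply: nearW => n.
rewrite f_beta_weight yE; have C0 := C_beta_gt0.
rewrite mulr_ge0 ?powR_ge0 ?(ltW C0)//= -mulrA ler_pM2l//.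
have u0 := onesqr_gt0 (n%:R : R).
apply: (@le_trans _ _ ((1 + n%:R ^+ 2) `^ (- (1 / 2)))).
  by rewrite ler_powR ?onesqr_ge1//; lra.
rewrite powRN ler_pdivlMr ?ltr0Sn// mulrC ler_pdivrMr ?powR_gt0//.
by rewrite -natr1 addrC onesqr_powR_half_ge.
Qed.

Lemma cauchy_entropy_le (f df K : R -> R) (M : R) :
  (forall x, 0 < f x) -> (forall x, f x <= M) ->
  (forall x : R, is_derive x 1 f (df x)) ->
  continuous K -> (leb R).-integrable setT (EFin \o K) ->
  (forall x, (1 + x ^+ 2) `^ alpha * df x ^+ 2 / f x * f_beta beta x <= K x) ->
  (leb R).-integrable setT (fun x => (f x * ln (f x) * f_beta beta x)%:E) ->
  \int[leb R]_x (f x * f_beta beta x) = 1 ->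
  \int[leb R]_x (f x * ln (f x) * f_beta beta x) <=
    (\int[leb R]_x K x) / (2 * rho beta alpha).
Proof.
have a_gt1 := alpha1; have a_ltb := alphabeta.
move=> f0 fM dF cK iK leK iflnf f1.
(* As alpha > 1, [k] is integrable, so the coordinate [prim k] is bounded by its total integral. *)
pose k x : R := (1 + x ^+ 2) `^ (- (alpha / 2)).
have ck : continuous k by exact: continuous_onesqr_powR.
have ik : (leb R).-integrable setT (EFin \o k).
  by apply: integrable_onesqr_powRN; lra.
have hB x : `|prim k x| <= \int[leb R]_x k x.
  have /andP[h0 hlt] := prim_gt0_lt x ck (fun t => powR_gt0 _ (onesqr_gt0 t)) ik.
  by rewrite gtr0_norm// ltW.
pose dq x := (2 * beta - alpha) * ((1 + x ^+ 2) `^ (alpha / 2 - 1)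
  + x * (2 * (alpha / 2 - 1) * x * (1 + x ^+ 2) `^ (alpha / 2 - 1 - 1))).
apply: (@entropy_le R (f_beta beta) a (prim k) V q dq (rho beta alpha)
  (\int[leb R]_x k x) rho_gt0 continuous_f_beta f_beta_gt0 integrable_f_beta
  Rintegral_f_beta _ _ hB _ _ _ _ _ _
  f df M f0 fM dF K cK iK _ iflnf f1).
- by move=> x; rewrite powR_gt0// onesqr_gt0.
- by move=> x; rewrite -powRN; exact: is_derive_prim.
- move=> x.
  have d1 : is_derive x 1 (fun y : R => 1 + y ^+ 2) (2 * x).
    by apply: is_derive_eq; rewrite /GRing.scale/=; ring.
  have d2 := @is_derive1_comp _ (@ln R) (fun y : R => 1 + y ^+ 2) _ _ _
    (is_derive1_ln (onesqr_gt0 x)) d1.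
  rewrite /V; apply: is_derive_eq; rewrite /GRing.scale/= /q /a.
  rewrite (powRD_gt0 _ _ (onesqr_gt0 x)) powR_inv1; last exact/ltW/onesqr_gt0.
  by field; rewrite !gt_eqF ?powR_gt0 ?onesqr_gt0.
- move=> x; have d1 := is_derive_onesqr_powR (alpha / 2 - 1) x.
  rewrite /q; apply: is_derive_eq; rewrite /GRing.scale/= /dq; ring.
(* Substituting x^2 = u - 1 turns [a x * dq x] into exactly the right-hand side of [rho_le]. *)
- move=> x; apply: le_trans (rho_le (onesqr_ge1 x)) _.
  set u := 1 + x ^+ 2; have u0 : 0 < u := onesqr_gt0 x.
  rewrite le_eqVlt; apply/orP; left; apply/eqP.
  rewrite /dq /a -/u.
  have e1 : u `^ (alpha / 2 - 1) = u `^ (alpha / 2 - 1 - 1) * u.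
    by rewrite -[X in _ = _ * X](powRr1 (ltW u0)) -powRD_gt0// subrK.
  have e2 : u `^ (alpha - 2) = u `^ (alpha / 2) * u `^ (alpha / 2 - 1 - 1).
    by rewrite -powRD_gt0//; congr powR; field.
  by rewrite e1 e2 /u; field.
- move=> x; rewrite f_beta_weight /V [X in expR X]opprB expRB lnK ?posrE ?C_beta_gt0//.
  by rewrite -expRN -[X in expR X]mulNr [X in expR X]mulrC expRM lnK// posrE onesqr_gt0.
- exact: f_beta_weight_cvg0.
- by apply: f_beta_weight_cvg0 => n; rewrite sqrrN.
- move=> x; rewrite /a -powR_mulrn ?powR_ge0// -powRrM.
  by rewrite divfK ?pnatr_eq0//; exact: leK.
Qed.

End generalized_cauchy.

(** * Perturbation of phi^2 by a positive constant, and its removal *)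

Section smooth.
Context {R : realType}.
Variables (alpha beta : R) (phi dphi : R -> R) (M : R).
Hypotheses (alpha1 : 1 < alpha) (alphabeta : alpha < beta)
  (dPhi : forall x : R, is_derive x 1 phi (dphi x))
  (phiM : forall x, `|phi x| <= M).
Hypothesis iphi : (leb R).-integrable setT
  (fun x => (phi x ^+ 2 * ln (phi x ^+ 2) * f_beta beta x)%:E).
Hypothesis cdphi : continuous dphi.

Let w := f_beta beta.
Let J x := (1 + x ^+ 2) `^ alpha * dphi x ^+ 2 * w x.
Hypothesis iJ : (leb R).-integrable setT (EFin \o J).

Let w0 x : 0 < w x. Proof. exact: f_beta_gt0 alpha1 alphabeta x. Qed.
Let cw : continuous w. Proof. exact: continuous_f_beta. Qed.
Let iw : (leb R).-integrable setT (EFin \o w).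
Proof. exact: integrable_f_beta alpha1 alphabeta. Qed.
Let w1 : \int[leb R]_x w x = 1. Proof. exact: Rintegral_f_beta alpha1 alphabeta. Qed.

Let cphi : continuous phi. Proof. exact: is_derive_continuous dPhi. Qed.

Let m0 := \int[leb R]_x (phi x ^+ 2 * w x).

Let phi2M x : phi x ^+ 2 <= M ^+ 2.
Proof. by have := phiM x; rewrite ler_norml => /andP[]; nra. Qed.

Let cphi2 : continuous (fun x => phi x ^+ 2).
Proof. by move=> x; apply: cvgM; exact: cphi. Qed.

Let iphi2 : (leb R).-integrable setT (EFin \o (fun x => phi x ^+ 2 * w x)).
Proof.
apply: (integrable_boundedM (M := M ^+ 2) cphi2 cw iw) => x.
by rewrite ger0_norm ?sqr_ge0.
Qed.

Let m0_ge0 : 0 <= m0.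
Proof. by apply: Rintegral_ge0 => x _; rewrite mulr_ge0 ?sqr_ge0// ltW. Qed.

Let cJ : continuous J.
Proof.
move=> x; apply: cvgM; last exact: cw.
apply: cvgM; first exact: continuous_onesqr_powR.
by apply: cvgM; exact: cdphi.
Qed.

(** The density inequality for f = (phi^2 + e) / m, multiplied by m; adding e makes f positive, and
    [m] normalizes it. *)
Lemma perturbed_entropy_le e : 0 < e ->
  \int[leb R]_x (phi x ^+ 2 * ln (phi x ^+ 2) * w x) + e * ln e
    - (m0 + e) * ln (m0 + e) <= 2 / rho beta alpha * \int[leb R]_x J x.
Proof.
move=> e0; set m := m0 + e.
have m_gt0 : 0 < m by rewrite ltr_wpDl.
have rho0 := rho_gt0 alpha1 alphabeta.
have g0 x : 0 < phi x ^+ 2 + e by rewrite ltr_wpDl// sqr_ge0.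
pose f x := (phi x ^+ 2 + e) / m.
pose df x := 2 * phi x * dphi x / m.
have f0 x : 0 < f x by rewrite divr_gt0.
have fM x : f x <= (M ^+ 2 + e) / m by rewrite ler_wpM2r ?lerD2r// invr_ge0 ltW.
have dF (x : R) : is_derive x 1 f (df x).
  have -> : f = (m^-1 *: (phi ^+ 2 + cst e)) :> (R -> R).
    by apply/funext => y; rewrite /f mulrC.
  apply: is_derive_eq; rewrite /GRing.scale/= /df; ring.
have cf : continuous f := is_derive_continuous dF.
have iflnf : (leb R).-integrable setT (EFin \o (fun x => f x * ln (f x) * w x)).
  apply: (integrable_boundedM (M := 1 + ((M ^+ 2 + e) / m) ^+ 2) _ cw iw) => x.
    apply: cvgM; first exact: cf.
    by apply: continuous_comp; [exact: cf|exact: continuous_ln].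
  exact: xlnx_norm_le.
have fwE : \int[leb R]_x (f x * w x) = 1.
  transitivity (\int[leb R]_x (m^-1 * (phi x ^+ 2 * w x + e * w x))).
    by apply: eq_Rintegral => x _; rewrite /f; ring.
  have iew : (leb R).-integrable setT (EFin \o (fun x => e * w x)).
    exact: (integrableZl measurableT e iw).
  rewrite RintegralZl//; last exact: (integrableD measurableT iphi2 iew).
  by rewrite RintegralD// RintegralZl// w1 mulr1 mulVf// gt_eqF.
(* f'^2 / f equals (4 / m) phi'^2 times phi^2 / (phi^2 + e), and the last factor is at most 1. *)
pose K x := 4 / m * J x.
have cK : continuous K by move=> x; apply: cvgM; [exact: cvg_cst|exact: cJ].
have iK : (leb R).-integrable setT (EFin \o K).
  exact: (integrableZl measurableT (4 / m) iJ).
have leK x : (1 + x ^+ 2) `^ alpha * df x ^+ 2 / f x * w x <= K x.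
  have -> : (1 + x ^+ 2) `^ alpha * df x ^+ 2 / f x * w x =
      K x * (phi x ^+ 2 / (phi x ^+ 2 + e)).
    by rewrite /K /J /df /f; field; rewrite !gt_eqF.
  rewrite ler_piMr//.
    rewrite mulr_ge0 ?divr_ge0 ?(ltW m_gt0)// mulr_ge0 ?(ltW (w0 _))//.
    by rewrite mulr_ge0 ?powR_ge0 ?sqr_ge0.
  by rewrite ler_pdivrMr// mul1r lerDl ltW.
have := cauchy_entropy_le alpha1 alphabeta f0 fM dF cK iK leK iflnf fwE.
rewrite RintegralZl// => ent.
(* A minorant of f ln f w by superadditivity; its integral splits into the entropy integral of
   phi^2, e ln e, and ln m. *)
pose l x := m^-1 * (phi x ^+ 2 * ln (phi x ^+ 2) * w x + e * ln e * w x)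
  - ln m * (f x * w x).
have ifw : (leb R).-integrable setT (EFin \o (fun x => f x * w x)).
  apply: (integrable_boundedM (M := (M ^+ 2 + e) / m) cf cw iw) => x.
  by rewrite ger0_norm ?fM// ltW.
have ielw : (leb R).-integrable setT (EFin \o (fun x => e * ln e * w x)).
  exact: (integrableZl measurableT (e * ln e) iw).
have il1 := integrableD measurableT iphi ielw.
have il2 := integrableZl measurableT (m^-1) il1.
have il3 := integrableZl measurableT (ln m) ifw.
have ll x : l x <= f x * ln (f x) * w x.
  have := xlnx_superadditive (sqr_ge0 (phi x)) e0.
  move=> /(ler_wpM2r (ltW (w0 x))) h.
  have mV0 : 0 <= m^-1 by rewrite invr_ge0 ltW.
  have := ler_wpM2l mV0 h.
  rewrite /l /f ln_div ?posrE//; lra.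
have il := integrableB measurableT il2 il3.
have := le_Rintegral measurableT il iflnf (fun x _ => ll x).
rewrite RintegralB// !RintegralZl// RintegralD// RintegralZl// w1 fwE !mulr1.
move=> /le_trans/(_ ent)/(ler_wpM2l (ltW m_gt0)).
set E0 := Rintegral _ _ _; set J0 := Rintegral _ _ _.
rewrite (_ : m * (_ - _) = E0 + e * ln e - m * ln m); last first.
  by field; rewrite gt_eqF.
rewrite (_ : m * (_ / _) = 2 / rho beta alpha * J0)//.
by field; rewrite !gt_eqF.
Qed.

Lemma smooth_entropy_le :
  Ent (f_beta beta) (fun x => phi x ^+ 2) <= 2 / rho beta alpha * \int[leb R]_x J x.
Proof.
rewrite /Ent -/w -/m0; apply/ler_addgt0Pr => d d0.
have m4 : 0 < 4 + m0 by rewrite ltr_pwDl.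
(* The shift is e = t^2; t <= 1 is required by [xlnxD_le], and the other bound keeps the error (4 +
   m0) t below d. *)
pose t := Num.min 1 (d / (4 + m0)).
have t01 : 0 < t <= 1 by rewrite lt_min ltr01 divr_gt0//= ge_min lexx.
have t2 : 0 < t ^+ 2 by rewrite exprn_gt0//; case/andP: t01.
have td : (4 + m0) * t <= d.
  by rewrite mulrC -ler_pdivlMr// ge_min lexx orbT.
have := perturbed_entropy_le t2; have := xlnxD_le m0_ge0 t01; lra.
Qed.

End smooth.

(** * The inequality in the extended reals *)

Theorem theorem3p1 (R : realType) (beta alpha : R) (phi : R -> R) :
  1 < beta -> 1 < alpha -> alpha < beta ->
  smooth phi ->
  (exists M : R, forall x : R, `|phi x| <= M) ->
  (leb R).-integrable setT
     (fun x => (phi x ^+ 2 * ln (phi x ^+ 2) * f_beta beta x)%:E) ->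
  ((Ent (f_beta beta) (fun x => phi x ^+ 2))%:E <=
   (2 / rho beta alpha)%:E *
   \int[leb R]_(x in setT)
      ((1 + x ^+ 2) `^ alpha * (derive1 phi x) ^+ 2 * f_beta beta x)%:E)%E.
Proof.
move=> _ alpha1 alphabeta sphi [M phiM] iphi.
have rho0 := rho_gt0 alpha1 alphabeta.
have dPhi (x : R) : is_derive x 1 phi (derive1 phi x).
  by rewrite derive1E; apply: derivableP; exact: (sphi 0%N).
have cdphi : continuous (derive1 phi).
  by move=> x; apply/differentiable_continuous/derivable1_diffP/(sphi 1%N).
set J := fun x => (1 + x ^+ 2) `^ alpha * derive1 phi x ^+ 2 * f_beta beta x.
have J0 x : 0 <= J x.
  rewrite mulr_ge0 ?(ltW (f_beta_gt0 alpha1 alphabeta x))//.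
  by rewrite mulr_ge0 ?powR_ge0 ?sqr_ge0.
have mJ : measurable_fun setT J.
  apply: continuous_measurable_fun => x.
  apply: cvgM; last exact: continuous_f_beta.
  apply: cvgM; first exact: continuous_onesqr_powR.
  by apply: cvgM; exact: cdphi.
(* An infinite right-hand side settles the claim, as [rho] is positive; otherwise [J] is integrable
   and the real inequality applies. *)
have [Joo|] := eqVneq (\int[leb R]_x (J x)%:E)%E +oo%E.
  by rewrite [X in (_ * X)%E]Joo gt0_muley ?leey// lte_fin divr_gt0.
rewrite -ltey => Jfin.
have iJ : (leb R).-integrable setT (EFin \o J).
  apply/integrableP; split; first exact/measurable_EFinP.
  by under eq_integral do rewrite /= ger0_norm//.
rewrite -[X in (_ * X)%E]fineK; last exact: integrable_fin_num iJ.
rewrite -EFinM lee_fin.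
exact: (smooth_entropy_le alpha1 alphabeta dPhi phiM iphi cdphi iJ).
Qed.
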